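(* For every integer $p\geq 0$, \[ \sum_{n=1}^\infty\frac{\binom{2n}{n}}{4^n n^{p+1}}=-2\,\zeta(\bar{1},\{\hat{1}\}_p)\,, \] where $\zeta(\bar 1,\{\hat 1\}_p)=\sum_{n_1>n_2>\cdots>n_{p+1}\geq 1}\frac{(-1)^{n_1}}{n_1}\prod_{j=2}^{p+1}\frac{1+(-1)^{n_j}}{n_j}$.
   Context: Notation for mixed multiple zeta values: for positive integers $s_1,\dots,s_m$, each possibly decorated by a bar, a hat or a tilde, $\zeta(s_1,\dots,s_m)$ denotes $\sum_{n_1>n_2>\cdots>n_m\geq 1}\prod_{j=1}^m \frac{\epsilon_j(n_j)}{n_j^{s_j}}$, where $\epsilon_j(n)=1$ if $s_j$ is undecorated, $(-1)^n$ if $s_j$ carries a bar ($\bar s_j$), $1+(-1)^n$ if it carries a hat ($\hat s_j$), and $1-(-1)^n$ if it carries a tilde ($\tilde s_j$); these are only used when the series converges. $\{a\}_p$ denotes $p$ repetitions of $a$, and $\{a\}_0$ is empty. For $p=0$, the right-hand side is $-2\zeta(\bar 1)=2\ln 2$. *)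

(* Defs.v *)
From mathcomp Require Import all_boot all_order all_algebra.
From mathcomp Require Import all_classical all_reals all_analysis.

Set Implicit Arguments.
Unset Strict Implicit.
Unset Printing Implicit Defensive.

Import Order.TTheory GRing.Theory Num.Theory.
Import numFieldNormedType.Exports.

Local Open Scope classical_set_scope.
Local Open Scope ring_scope.

Inductive decoration := Plain | Bar | Hat | Tilde.

(* An argument of a mixed multiple zeta value: a (positive) exponent together
   with its decoration, e.g. (1%N, Bar) is 1 with a bar. *)
Definition mzv_arg : Type := nat * decoration.

Definition deco_sign (R : realType) (d : decoration) (n : nat) : R :=
  match d with
  | Plain => 1
  | Bar => (-1) ^+ n
  | Hat => 1 + (-1) ^+ n
  | Tilde => 1 - (-1) ^+ n
  end.

Definition mzv_factor (R : realType) (a : mzv_arg) (n : nat) : R :=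
  deco_sign R a.2 n / n%:R ^+ a.1.

(* Sum over N >= n_1 > ... > n_m >= 1, where m is the length of s. *)
Definition mzv_trunc (R : realType) (s : seq mzv_arg) (N : nat) : R :=
  \sum_(n : (size s).-tuple 'I_N.+1 |
          sorted gtn (map val n) && all (leq 1) (map val n))
    \prod_(j < size s) mzv_factor R (tnth (in_tuple s) j) (tnth n j).

(* The series may converge only conditionally: its value is the limit of the
   truncations of the outermost variable n_1.  The value is meaningful only if
   [mzv_converges] holds. *)
Definition mzv_converges (R : realType) (s : seq mzv_arg) : Prop :=
  cvgn (mzv_trunc R s).

Definition mzv (R : realType) (s : seq mzv_arg) : R := limn (mzv_trunc R s).

Definition central_binomial_sum (R : realType) (p N : nat) : R :=
  \sum_(1 <= n < N.+1) 'C(2 * n, n)%:R / (4%:R ^+ n * n%:R ^+ p.+1).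

(* Main.v *)
(* With [C(n,b) = n! b! / (n+b)!] one has
   [(C(n,b) - C(n,b+1)) / n = C(n,b+1) / (b+1)], so each factor [1/n] can be
   traded for a sum over a new outermost index [b]:
     [1 / n^(p+1) = sum_(b >= 0) e_p(b) / (b+1) * C(n,b+1)],
   where [e_p(b) = e_p(1, 1/2, ..., 1/b)] is elementary symmetric.  Weighting by
   [a_n = binom(2n,n) / 4^n] and summing over [n] first (the sum over [n]
   telescopes to [1 / (2b+1)]) turns the left-hand side into
     [sum_(b >= 0) e_p(b) / ((b+1)(2b+1))].
   On the other side only even indices contribute to the hat factors, and
   [n_1 = 2b+1], [n_1 = 2b+2] together give
   [- e_p(b) (1/(2b+1) - 1/(2b+2))], i.e. [-1/2] times the same summand.
   The interchange of sums is replaced by two-sided bounds on partial sums whose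
   errors vanish because [a_N -> 0] and [e_p(N) = o(N)]. *)
Require Import Defs.
From mathcomp Require Import all_boot all_order all_algebra.
From mathcomp Require Import all_classical all_reals all_analysis.
From mathcomp Require Import ring lra zify.

Import Order.TTheory GRing.Theory Num.Theory.
Import numFieldNormedType.Exports.

Local Open Scope classical_set_scope.
Local Open Scope ring_scope.

(** * Elementary symmetric sums of reciprocals and their sublinear growth *)

(* The elementary symmetric polynomial of degree [p] in [1, 1/2, ..., 1/n]. *)
Fixpoint harmonic_esym (R : realType) (p : nat) : R^nat :=
  if p is q.+1 then series (fun b => harmonic_esym R q b / b.+1%:R)
  else fun=> 1.

Lemma harmonic_esym_ge0 (R : realType) p n : 0 <= harmonic_esym R p n.
Proof.
elim: p n => [|p IH] n /=; first exact: ler01.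
by rewrite /series; apply: sumr_ge0 => b _; rewrite divr_ge0.
Qed.

Lemma harmonic_esymS (R : realType) p n :
  harmonic_esym R p.+1 n.+1
  = harmonic_esym R p.+1 n + harmonic_esym R p n / n.+1%:R.
Proof. by rewrite /= /series /= big_nat_recr. Qed.

Lemma harmonic_esym_sublinear (R : realType) p :
  (fun n => harmonic_esym R p n.+1 / n.+1%:R) @ \oo --> (0 : R).
Proof.
elim: p => [|p IH] /=.
  under eq_fun do rewrite div1r; exact: cvg_harmonic.
under eq_fun do rewrite mulrC.
(* Cesaro: the quotient is the mean of the [e_p(b) / (b+1)], [b <= n]. *)
apply: cesaro; rewrite -cvg_shiftS /=.
(* After the shift the averaged term is [e_p(n+1) / (n+2)], dominated by the quotient of the
   induction hypothesis. *)
apply: (@squeeze_cvgr _ _ _ _ (fun=> 0)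
  (fun n => harmonic_esym R p n.+1 / n.+1%:R)) => //; last exact: cvg_cst.
apply: nearW => n /=; rewrite divr_ge0 ?harmonic_esym_ge0 //=.
rewrite ler_wpM2l ?harmonic_esym_ge0 // lef_pV2 ?posrE ?ltr0n //.
by rewrite ler_nat.
Qed.

(** * The connector, an inverse binomial coefficient, and the expansion of [1 / n^(p+1)] *)

Definition connector (R : realType) (n b : nat) : R :=
  (n`! * b`!)%:R / (n + b)`!%:R.

Lemma connector_ge0 (R : realType) n b : 0 <= connector R n b.
Proof. by rewrite divr_ge0. Qed.

Lemma connectorn0 (R : realType) n : connector R n 0 = 1.
Proof.
by rewrite /connector addn0 fact0 muln1 divff // pnatr_eq0 -lt0n fact_gt0.
Qed.

Lemma connector_succl (R : realType) n b :
  connector R n.+1 b = connector R n b * n.+1%:R / (n + b).+1%:R.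
Proof.
rewrite /connector addSn !factS !natrM.
have f0 : ((n + b)`!%:R : R) != 0 by rewrite pnatr_eq0 -lt0n fact_gt0.
have nb : ((n + b).+1%:R : R) != 0 by rewrite pnatr_eq0.
move: f0 nb; move: ((n + b).+1%:R) ((n + b)`!%:R) => x y y0 x0.
by field; rewrite x0 y0.
Qed.

Lemma connector_succr (R : realType) n b :
  connector R n b.+1 = connector R n b * b.+1%:R / (n + b).+1%:R.
Proof.
rewrite /connector addnS !factS !natrM.
have f0 : ((n + b)`!%:R : R) != 0 by rewrite pnatr_eq0 -lt0n fact_gt0.
have nb : ((n + b).+1%:R : R) != 0 by rewrite pnatr_eq0.
move: f0 nb; move: ((n + b).+1%:R) ((n + b)`!%:R) => x y y0 x0.
by field; rewrite x0 y0.
Qed.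

Lemma connector_transport (R : realType) n b : (0 < n)%N ->
  connector R n b.+1 / b.+1%:R
  = (connector R n b - connector R n b.+1) / n%:R.
Proof.
move=> n0; rewrite connector_succr.
rewrite -[(n + b).+1]addn1 -[b.+1]addn1 !natrD.
have nb : (n%:R + b%:R + 1 : R) != 0 by rewrite -?natrD ?natr1 pnatr_eq0; lia.
have bb : (b%:R + 1 : R) != 0 by rewrite -?natrD ?natr1 pnatr_eq0; lia.
by field; rewrite nb bb pnatr_eq0 -lt0n n0.
Qed.

(** Equality holds at [b = 0], and each further step in [b] multiplies by [(b+2) / (n+b+2) <= 1]. *)
Lemma connector_le (R : realType) n b : connector R n b.+1 <= n.+1%:R^-1.
Proof.
elim: b => [|b IH].
  by rewrite connector_succr connectorn0 addn0 !mul1r.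
rewrite connector_succr; apply: le_trans IH.
rewrite -mulrA ler_piMr ?connector_ge0 // ler_pdivrMr ?ltr0n // mul1r.
by rewrite ler_nat; lia.
Qed.

Definition connected_sum (R : realType) (p n B : nat) : R :=
  \sum_(0 <= b < B) harmonic_esym R p b / b.+1%:R * connector R n b.+1.

Lemma connected_sum0 (R : realType) n B : (0 < n)%N ->
  connected_sum R 0 n B = (1 - connector R n B) / n%:R.
Proof.
move=> n0; rewrite /connected_sum; elim: B => [|B IH].
  by rewrite big_nil connectorn0 subrr mul0r.
rewrite big_nat_recr //= IH div1r [X in _ + X]mulrC.
rewrite connector_transport // -mulrDl.
by congr (_ / _); ring.
Qed.

(** Abel summation: transport turns the summand into [e_(p+1)(b) (C(n,b) - C(n,b+1)) / n], and the
    increments of [e_(p+1)] are [e_p(b) / (b+1)]. The boundary term at [0] vanishes; the one at [B]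
    remains. *)
Lemma connected_sumS (R : realType) p n B : (0 < n)%N ->
  connected_sum R p.+1 n B
  = (connected_sum R p n B - harmonic_esym R p.+1 B * connector R n B) / n%:R.
Proof.
move=> n0; elim: B => [|B IH].
  by rewrite /connected_sum !big_nil /= /series /= big_nil mul0r subrr mul0r.
have E q : connected_sum R q n B.+1 = connected_sum R q n B
    + harmonic_esym R q B / B.+1%:R * connector R n B.+1.
  by rewrite /connected_sum big_nat_recr.
rewrite !E IH harmonic_esymS.
rewrite [X in _ + X = _]mulrAC -[X in _ + X = _]mulrA connector_transport //.
by move: (n%:R^-1) (B.+1%:R^-1) => x y; ring.
Qed.

(** Each level of the recursion leaves one nonnegative boundary term [e_j(B) C(n,B)]; its powers of
    [1/n] are bounded by [1]. *)
Lemma connected_sum_bounds (R : realType) p n B : (0 < n)%N ->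
  connected_sum R p n B <= (n%:R ^+ p.+1)^-1
    <= connected_sum R p n B
       + connector R n B * \sum_(j < p.+1) harmonic_esym R j B.
Proof.
move=> n0; have n1 : n%:R^-1 <= 1 :> R by rewrite invf_le1 ?ltr0n // ler1n.
have ni : 0 <= n%:R^-1 :> R by rewrite invr_ge0.
have c0 := connector_ge0 R n B.
elim: p => [|p /andP[IH1 IH2]].
  rewrite connected_sum0 // expr1 big_ord_recr big_ord0 /= add0r mulr1; nra.
have h0 := harmonic_esym_ge0 R p.+1 B.
have hc : 0 <= harmonic_esym R p.+1 B * connector R n B by rewrite mulr_ge0.
rewrite big_ord_recr /= -/(harmonic_esym R p.+1 B) connected_sumS //.
rewrite [n%:R ^+ p.+2]exprSr invfM.
set s := \sum_(j < p.+1) _ in IH2 *.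
have s0 : 0 <= s by apply: sumr_ge0 => j _; exact: harmonic_esym_ge0.
have sc : 0 <= connector R n B * s by rewrite mulr_ge0.
move: IH1 IH2; set X := (_ ^+ _)^-1; set A := connected_sum _ _ _ _.
set h := harmonic_esym _ _ _ in h0 hc *.
set c := connector _ _ _ in c0 hc sc *.
move: (n%:R^-1) n1 ni => i i1 i0 IH1 IH2.
apply/andP; split.
  apply: ler_wpM2r => //; lra.
rewrite mulrDr [c * h]mulrC.
apply: le_trans (ler_wpM2r i0 IH2) _.
have : (h * c + c * s) * i <= h * c + c * s by apply: ler_piMr => //; lra.
lra.
Qed.

(** * The weights [binom(2n,n) / 4^n] *)

Definition central_ratio (R : realType) (n : nat) : R :=
  'C(2 * n, n)%:R / 4%:R ^+ n.

Lemma central_ratio_ge0 (R : realType) n : 0 <= central_ratio R n.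
Proof. by rewrite divr_ge0. Qed.

Lemma central_ratio0 (R : realType) : central_ratio R 0 = 1.
Proof. by rewrite /central_ratio muln0 bin0 divr1. Qed.

Lemma central_ratioS (R : realType) n :
  central_ratio R n.+1 = central_ratio R n * (2 * n).+1%:R / (2 * n.+1)%:R.
Proof.
have E m : 'C(2 * m, m)%:R = (2 * m)`!%:R / (m`!%:R ^+ 2) :> R.
  have := @bin_fact (2 * m) m ltac:(lia).
  rewrite (_ : 2 * m - m = m)%N; last lia.
  move=> <-; rewrite !natrM; field.
  by rewrite pnatr_eq0 -lt0n fact_gt0.
rewrite /central_ratio !E (_ : 2 * n.+1 = (2 * n).+2)%N; last lia.
rewrite !factS !natrM [4 ^+ _]exprS.
have -> : (2 * n).+2%:R = 2 * n%:R + 2 :> R by rewrite -addn2 natrD natrM.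
have -> : (2 * n).+1%:R = 2 * n%:R + 1 :> R by rewrite -natr1 natrM.
rewrite -!(natr1 n).
have nb : (n%:R + 1 : R) != 0 by rewrite -?natrD ?natr1 pnatr_eq0; lia.
have nc : (2 * n%:R + 2 : R) != 0.
  by rewrite -natrM -?natrD ?natr1 pnatr_eq0; lia.
field.
by rewrite nb nc expf_neq0 ?pnatr_eq0 //= -lt0n fact_gt0.
Qed.

(** With [T_n = (2n+1) a_n C(n,b+1)], the summand times [2b+1] is [T_(n-1) - T_n], and [T_0 = 1]. *)
Lemma sum_central_ratio_connector (R : realType) b N :
  \sum_(1 <= n < N.+1) central_ratio R n * connector R n b.+1
  = (1 - (2 * N).+1%:R * central_ratio R N * connector R N b.+1)
    / (2 * b).+1%:R.
Proof.
elim: N => [|N IH].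
  rewrite big_geq // muln0 central_ratio0 /connector add0n fact0 mul1n divff;
    last by rewrite pnatr_eq0 -lt0n fact_gt0.
  by rewrite !mulr1 subrr mul0r.
rewrite big_nat_recr //= IH central_ratioS connector_succl.
have -> : (2 * N.+1).+1%:R = 2 * N%:R + 3 :> R.
  by rewrite -natrM -natrD; congr _%:R; lia.
have -> : (N + b.+1).+1%:R = N%:R + b%:R + 2 :> R.
  by rewrite -!natrD; congr _%:R; lia.
rewrite -!(natr1 N) -!(natr1 (2 * _)) !natrM -!(natr1 N).
have nb : (N%:R + b%:R + 2 : R) != 0 by rewrite -?natrD ?natr1 pnatr_eq0; lia.
have nc : (N%:R + 1 : R) != 0 by rewrite -?natrD ?natr1 pnatr_eq0; lia.
have nd : (2 * b%:R + 1 : R) != 0.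
  by rewrite -natrM -?natrD ?natr1 pnatr_eq0; lia.
by field; rewrite ?nb ?nc ?nd.
Qed.

Lemma central_ratio_sqr_le (R : realType) n :
  central_ratio R n ^+ 2 <= n.+1%:R^-1.
Proof.
(* This sharper bound is inductive, since [(2n+1)(2n+3) <= (2n+2)^2]. *)
suff H : central_ratio R n ^+ 2 * (2 * n).+1%:R <= 1.
  have a0 := sqr_ge0 (central_ratio R n).
  rewrite -div1r ler_pdivlMr ?ltr0n //; apply: le_trans H.
  by rewrite ler_wpM2l // ler_nat; lia.
elim: n => [|n IH]; first by rewrite central_ratio0 expr1n muln0 mulr1.
apply: le_trans IH; rewrite central_ratioS.
have E (a x y z : R) : (a * x / y) ^+ 2 * z = a ^+ 2 * (x ^+ 2 * z / y ^+ 2).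
  by rewrite -exprVn; move: y^-1 => y'; ring.
rewrite E ler_wpM2l ?sqr_ge0 // ler_pdivrMr ?exprn_gt0 ?ltr0n //.
by rewrite -!natrX -!natrM ler_nat; nia.
Qed.

Lemma central_ratio_cvg0 (R : realType) : central_ratio R @ \oo --> (0 : R).
Proof.
apply: (@squeeze_cvgr _ _ _ _ (fun=> 0) (fun n => Num.sqrt (harmonic n))).
- apply: nearW => n; rewrite central_ratio_ge0 /=.
  rewrite -[leLHS]ger0_norm ?central_ratio_ge0 // -sqrtr_sqr.
  by rewrite ler_wsqrtr // central_ratio_sqr_le.
- exact: cvg_cst.
- rewrite -[X in _ --> X](@sqrtr0 R).
  exact: (cvg_comp (@harmonic R) Num.sqrt cvg_harmonic (@sqrt_continuous R 0)).
Qed.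

(** * The intermediate series and its comparison with the central binomial sum *)

Definition even_mzv_sum (R : realType) (p : nat) : R^nat :=
  series (fun b => harmonic_esym R p b / (b.+1 * (2 * b).+1)%:R).

Lemma sum_central_ratio_connected_sum (R : realType) p B N :
  \sum_(1 <= n < N.+1) central_ratio R n * connected_sum R p n B
  = \sum_(0 <= b < B) harmonic_esym R p b / (b.+1 * (2 * b).+1)%:R
      * (1 - (2 * N).+1%:R * central_ratio R N * connector R N b.+1).
Proof.
under eq_bigr do rewrite /connected_sum big_distrr.
rewrite exchange_big /=; apply: eq_bigr => b _.
under eq_bigr do rewrite mulrCA.
rewrite -big_distrr /= sum_central_ratio_connector natrM invfM.
by rewrite -!mulrA; congr (_ * (_ * _)); exact: mulrC.
Qed.

(** The bound is uniform in [b], so the truncation in [n] costs a single factor [1 - 2 a_N] for the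
    whole sum over [b]. *)
Lemma central_ratio_tail_bounds (R : realType) N b :
  0 <= (2 * N).+1%:R * central_ratio R N * connector R N b.+1
    <= 2 * central_ratio R N.
Proof.
have a0 := central_ratio_ge0 R N; have c0 := connector_ge0 R N b.+1.
rewrite !mulr_ge0 //= mulrAC ler_wpM2r //.
apply: le_trans (ler_wpM2l _ (connector_le R N b)) _ => //.
by rewrite ler_pdivrMr ?ltr0n // -natrM ler_nat; lia.
Qed.

Lemma sum_central_ratio_connected_sum_bounds (R : realType) p B N :
  even_mzv_sum R p B * (1 - 2 * central_ratio R N)
  <= \sum_(1 <= n < N.+1) central_ratio R n * connected_sum R p n B
  <= even_mzv_sum R p B.
Proof.
rewrite sum_central_ratio_connected_sum /even_mzv_sum /series /=.
rewrite big_distrl /=; apply/andP; split; apply: ler_sum => b _.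
  rewrite ler_wpM2l ?divr_ge0 ?harmonic_esym_ge0 //.
  by have /andP[_] := central_ratio_tail_bounds R N b; lra.
rewrite ler_piMr ?divr_ge0 ?harmonic_esym_ge0 //.
by have /andP[+ _] := central_ratio_tail_bounds R N b; lra.
Qed.

Lemma central_binomial_sumE (R : realType) p N :
  central_binomial_sum R p N
  = \sum_(1 <= n < N.+1) central_ratio R n * (n%:R ^+ p.+1)^-1.
Proof. by apply: eq_bigr => n _; rewrite /central_ratio invfM mulrA. Qed.

Lemma central_binomial_sum_ge (R : realType) p B N :
  even_mzv_sum R p B * (1 - 2 * central_ratio R N)
  <= central_binomial_sum R p N.
Proof.
have /andP[H _] := sum_central_ratio_connected_sum_bounds R p B N.
apply: le_trans H _; rewrite central_binomial_sumE.
apply: ler_sum_nat => n /andP[n0 _]; rewrite ler_wpM2l ?central_ratio_ge0 //.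
by have /andP[] := connected_sum_bounds R p n B n0.
Qed.

(** Weighted by [a_n], the errors [E * C(n,B+1)] sum to at most [E / (2B+1)], whatever [N] is. *)
Lemma central_binomial_sum_le (R : realType) p B N :
  central_binomial_sum R p N <= even_mzv_sum R p B.+1
    + \sum_(j < p.+1) harmonic_esym R j B.+1 / B.+1%:R.
Proof.
have /andP[_ H] := sum_central_ratio_connected_sum_bounds R p B.+1 N.
set E := \sum_(j < p.+1) harmonic_esym R j B.+1.
have E0 : 0 <= E by apply: sumr_ge0 => j _; exact: harmonic_esym_ge0.
apply: (@le_trans _ _
  (\sum_(1 <= n < N.+1) (central_ratio R n * connected_sum R p n B.+1
     + E * (central_ratio R n * connector R n B.+1)))).
  rewrite central_binomial_sumE; apply: ler_sum_nat => n /andP[n0 _].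
  have /andP[_ K] := connected_sum_bounds R p n B.+1 n0.
  apply: le_trans (ler_wpM2l (central_ratio_ge0 R n) K) _.
  by rewrite mulrDr [E * _]mulrC mulrA.
rewrite big_split /= lerD // -big_distrr /= -mulr_suml ler_wpM2l //.
rewrite sum_central_ratio_connector.
apply: (@le_trans _ _ ((2 * B).+1%:R^-1)).
  rewrite ler_piMl //.
  by have /andP[+ _] := central_ratio_tail_bounds R N B; lra.
by rewrite lef_pV2 ?posrE ?ltr0n // ler_nat; lia.
Qed.

Lemma is_cvg_central_binomial_sum (R : realType) p :
  cvgn (central_binomial_sum R p).
Proof.
apply: nondecreasing_is_cvgn.
  apply/nondecreasing_seqP => n; rewrite /central_binomial_sum.
  by rewrite [leRHS]big_nat_recr //= lerDl divr_ge0 // mulr_ge0 // exprn_ge0.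
(* The upper bound at [B = 0], which is independent of [N]. *)
by exists (even_mzv_sum R p 1
  + \sum_(j < p.+1) harmonic_esym R j 1 / 1%:R) => _ [N _ <-];
  exact: central_binomial_sum_le.
Qed.

Lemma even_mzv_sum_cvg (R : realType) p :
  even_mzv_sum R p @ \oo --> limn (central_binomial_sum R p).
Proof.
set S := central_binomial_sum R p; set l := limn _.
have Sl : S @ \oo --> l by exact: is_cvg_central_binomial_sum.
have a0 := @central_ratio_cvg0 R.
rewrite -cvg_shiftS.
(* Taking [B] on the diagonal with [N], both inequalities are solved for [even_mzv_sum R p N.+1]. *)
apply: (@squeeze_cvgr _ _ _ _
  (fun N => S N - \sum_(j < p.+1) harmonic_esym R j N.+1 / N.+1%:R)
  (fun N => S N / (1 - 2 * central_ratio R N))).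
- near=> N; rewrite lerBlDr central_binomial_sum_le /=.
  rewrite ler_pdivlMr; first exact: central_binomial_sum_ge.
  (* The divisor [1 - 2 a_N] is positive only eventually: [a_0 = 1] and [a_1 = 1/2]. *)
  suff : central_ratio R N < 2^-1 by lra.
  by near: N; apply: (cvgr_lt 0) => //; rewrite invr_gt0.
- rewrite -[X in _ --> X]subr0; apply: cvgB => //.
  rewrite [X in _ --> X](_ : 0 = \sum_(j < p.+1) 0); last by rewrite big1.
  apply: (@cvg_big _ _ +%R) => [|j _]; last exact: harmonic_esym_sublinear.
  exact: add_continuous.
- rewrite -[X in _ --> X]divr1 -[in X in _ --> X](subr0 1).
  rewrite -[in X in _ --> X](mulr0 2).
  apply: cvgM => //; apply: cvgV; first by rewrite mulr0 subr0 oner_eq0.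
  by apply: cvgB; [exact: cvg_cst|apply: cvgM => //; exact: cvg_cst].
Unshelve. all: by end_near. Qed.

(** * Truncated multiple zeta values as iterated sums *)

Fixpoint mzv_rec (R : realType) (s : seq mzv_arg) (N : nat) : R :=
  if s is a :: s' then
    \sum_(1 <= n < N.+1) mzv_factor R a n * mzv_rec R s' n.-1
  else 1.

(* The bound [M] on the indices is separate from the type bound [K] so that the
   induction, which lowers [M], keeps the index type fixed. *)
Lemma mzv_rec_bounded (R : realType) s K M : (M <= K)%N ->
  \sum_(n : (size s).-tuple 'I_K |
          sorted gtn (map val n) && all (leq 1) (map val n)
          && all (fun i => i < M)%N (map val n))
    \prod_(j < size s) mzv_factor R (tnth (in_tuple s) j) (tnth n j)
  = mzv_rec R s M.-1.
Proof.
elim: s M => [|a s IH] M MK /=.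
  rewrite (big_pred1 [tuple]) ?big_ord0 // => t; rewrite (tuple0 t) /=.
  by rewrite eqxx.
pose h (x : 'I_K * (size s).-tuple 'I_K) : (size s).+1.-tuple 'I_K :=
  [tuple of x.1 :: x.2].
(* Splitting a tuple into head and tail isolates the outermost index. *)
rewrite (reindex h); last first.
  exists (fun t => (thead t, [tuple of behead t])) => [[i t] _|t _] /=.
    by congr pair; apply: val_inj.
  by rewrite /h /= -tuple_eta.
transitivity (\sum_(i < K | (0 < i < M)%N) \sum_(t : (size s).-tuple 'I_K |
    sorted gtn (map val t) && all (leq 1) (map val t)
    && all (fun j => j < i)%N (map val t))
    mzv_factor R a i *
    \prod_(j < size s) mzv_factor R (tnth (in_tuple s) j) (tnth t j)).
  rewrite pair_big_dep /=; apply: eq_big => [[i t] /=|[i t] _ /=].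
    rewrite (path_sortedE (rev_trans ltn_trans)).
    set u := map _ t; set P1 := all (gtn i) u.
    (* Entries below the head [i] are below [M] as well, so in the tail the bound [M] can be
       replaced by [i]. *)
    have H : P1 -> (i < M)%N -> all (fun j => j < M)%N u.
      by move=> /allP Hu iM; apply/allP => j /Hu /= ji; apply: ltn_trans iM.
    case: P1 H; last by rewrite !andbF.
    case: (i < M)%N => /=; last by rewrite !andbF.
    by move=> ->//; rewrite !andbT andbCA.
  rewrite big_ord_recl; congr (_ * _).
  by apply: eq_bigr => j _; rewrite !(tnth_nth i) !(tnth_nth a).
transitivity (\sum_(i < K | (0 < i < M)%N) mzv_factor R a i * mzv_rec R s i.-1).
  by apply: eq_bigr => i _; rewrite -mulr_sumr IH // ltnW.
rewrite -(big_ord_widen_cond K (fun i => 0 < i)%N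
   (fun i => mzv_factor R a i * mzv_rec R s i.-1)) //.
case: M {MK} => [|M] /=; first by rewrite big_ord0 big_geq.
rewrite big_mkcond big_ord_recl /= add0r big_add1 big_mkord.
by apply: eq_bigr.
Qed.

Lemma mzv_truncE (R : realType) s N : mzv_trunc R s N = mzv_rec R s N.
Proof.
rewrite -[N in RHS]/N.+1.-1 -(mzv_rec_bounded R s N.+1) //.
rewrite /mzv_trunc; apply: eq_bigl => t.
rewrite [X in _ = _ && X](_ : _ = true) ?andbT //.
by apply/allP => j /mapP[i _ ->]; exact: ltn_ord.
Qed.

(** Odd indices contribute [0], and an even index [2m] contributes [2 / (2m) = 1/m]. *)
Lemma mzv_rec_hat (R : realType) p N :
  mzv_rec R (nseq p (1%N, Hat)) N = harmonic_esym R p N./2.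
Proof.
elim: p N => [//|p IH] N.
elim: N => [|N IHN]; first by rewrite /= big_geq // /series /= big_nil.
have -> : mzv_rec R (nseq p.+1 (1%N, Hat)) N.+1
    = mzv_rec R (nseq p.+1 (1%N, Hat)) N
      + mzv_factor R (1%N, Hat) N.+1 * harmonic_esym R p N./2.
  by rewrite /= big_nat_recr //= IH.
rewrite IHN /mzv_factor /= expr1 uphalf_half -signr_odd /=.
rewrite -[N in N.+1%:R]odd_double_half.
case: (odd N) (N./2) => M; last by rewrite /= expr1 subrr !mul0r addr0.
rewrite !add1n -doubleS -muln2 natrM expr0.
rewrite -!/(harmonic_esym R p.+1 _) harmonic_esymS.
have : (M.+1%:R : R) != 0 by rewrite pnatr_eq0.
by move: M.+1%:R (harmonic_esym R p.+1 M) => x y x0; field.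
Qed.

(** * Truncations of the alternating side and passage to the limit *)

Lemma mzv_trunc_bar_hatS (R : realType) p N :
  mzv_trunc R ((1%N, Bar) :: nseq p (1%N, Hat)) N.+1
  = mzv_trunc R ((1%N, Bar) :: nseq p (1%N, Hat)) N
    + (-1) ^+ N.+1 / N.+1%:R * harmonic_esym R p N./2.
Proof. by rewrite !mzv_truncE /= big_nat_recr //= mzv_rec_hat. Qed.

(** The indices [2M+1] and [2M+2] carry the same inner sum [e_p(M)], so they can be paired. *)
Lemma mzv_trunc_bar_hat_double (R : realType) p M :
  mzv_trunc R ((1%N, Bar) :: nseq p (1%N, Hat)) M.*2
  = - 2^-1 * even_mzv_sum R p M.
Proof.
elim: M => [|M IH].
  by rewrite mzv_truncE /= big_geq // /even_mzv_sum /series /= big_nil mulr0.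
rewrite doubleS 2!mzv_trunc_bar_hatS IH -[M.*2.+1./2]/(uphalf M.*2).
rewrite uphalf_double doubleK.
have -> : even_mzv_sum R p M.+1 = even_mzv_sum R p M
    + harmonic_esym R p M / (M.+1 * (2 * M).+1)%:R.
  by rewrite /even_mzv_sum /series /= big_nat_recr.
rewrite -signr_odd -[(-1) ^+ M.*2.+2]signr_odd /= odd_double expr0 expr1.
rewrite -doubleS -!muln2 !natrM mulnC.
rewrite -[(2 * M).+1]addn1 natrD natrM -!(natr1 M).
have m1 : (M%:R + 1 : R) != 0 by rewrite natr1 pnatr_eq0.
have m2 : (2 * M%:R + 1 : R) != 0 by rewrite -natrM natr1 pnatr_eq0.
by field; rewrite m1 m2.
Qed.

Lemma harmonic_esym_leS (R : realType) p n :
  harmonic_esym R p n <= harmonic_esym R p n.+1.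
Proof.
case: p => [//|p]; rewrite harmonic_esymS lerDl.
by rewrite divr_ge0 ?harmonic_esym_ge0.
Qed.

(** An odd truncation differs from the preceding even one by a single term. Its bound is given the
    form to which [harmonic_esym_sublinear] applies. *)
Lemma mzv_trunc_bar_hat_bounds (R : realType) p N :
  even_mzv_sum R p N./2
  <= - 2 * mzv_trunc R ((1%N, Bar) :: nseq p (1%N, Hat)) N
  <= even_mzv_sum R p N./2
     + 2 * (harmonic_esym R p N./2.+1 / N./2.+1%:R).
Proof.
rewrite -[N in mzv_trunc _ _ N]odd_double_half.
have : 0 <= harmonic_esym R p N./2.+1 / N./2.+1%:R.
  by rewrite divr_ge0 ?harmonic_esym_ge0.
case: (odd N); move: N./2 => M h0; last first.
  rewrite add0n mzv_trunc_bar_hat_double.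
  move: (_ / _) (even_mzv_sum _ _ _) h0 => h t h0.
  by apply/andP; split; lra.
rewrite add1n mzv_trunc_bar_hatS mzv_trunc_bar_hat_double doubleK.
rewrite -signr_odd /= odd_double expr1.
have e0 := harmonic_esym_ge0 R p M.
have : M.*2.+1%:R^-1 * harmonic_esym R p M
    <= harmonic_esym R p M.+1 / M.+1%:R.
  rewrite mulrC ler_pM ?harmonic_esym_leS //.
  by rewrite lef_pV2 ?posrE ?ltr0n // ler_nat; lia.
have : 0 <= M.*2.+1%:R^-1 * harmonic_esym R p M by rewrite mulr_ge0.
rewrite mulN1r !mulNr; move: (M.*2.+1%:R^-1 * _) => x.
move: (_ / _) (even_mzv_sum _ _ _) h0 => h t h0 x0 xh.
by apply/andP; split; lra.
Qed.

Lemma cvg_half : half @ \oo --> \oo.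
Proof.
apply/cvgnyPge => A; exists A.*2 => // n /= An.
by rewrite geq_half_double.
Qed.

Theorem theorem2p2 (R : realType) (p : nat) :
  [/\ cvgn (central_binomial_sum R p),
      mzv_converges R ((1%N, Bar) :: nseq p (1%N, Hat)) &
      limn (central_binomial_sum R p)
        = - 2%:R * mzv R ((1%N, Bar) :: nseq p (1%N, Hat))].
Proof.
set l := limn _; set F := mzv_trunc R ((1%N, Bar) :: nseq p (1%N, Hat)).
have Tl : even_mzv_sum R p n./2 @[n --> \oo] --> l.
  exact: (cvg_comp half _ cvg_half (@even_mzv_sum_cvg R p)).
have El : 2 * (harmonic_esym R p n./2.+1 / n./2.+1%:R) @[n --> \oo] --> (0 : R).
  rewrite -[X in _ --> X](mulr0 2); apply: cvgM; first exact: cvg_cst.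
  exact: (cvg_comp half _ cvg_half (@harmonic_esym_sublinear R p)).
have Gl : - 2 * F n @[n --> \oo] --> l.
  apply: (@squeeze_cvgr _ _ _ _ (fun n => even_mzv_sum R p n./2)
    (fun n => even_mzv_sum R p n./2
              + 2 * (harmonic_esym R p n./2.+1 / n./2.+1%:R))) => //.
    by apply: nearW => n; exact: mzv_trunc_bar_hat_bounds.
  by rewrite -[X in _ --> X]addr0; exact: cvgD Tl El.
(* Undoing the factor [-2] gives convergence of the truncations themselves, hence both
   [mzv_converges] and the value. *)
have Fl : F @ \oo --> - 2^-1 * l.
  rewrite (_ : F = fun n => - 2^-1 * (- 2 * F n)).
    by apply: cvgM => //; exact: cvg_cst.
  by apply/funext => n; field.
split.
- exact: is_cvg_central_binomial_sum.
- by apply/cvg_ex; exists (- 2^-1 * l).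
- by rewrite /mzv (cvg_lim _ Fl) //; field.
Qed.
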